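(* Let $(G,X,x_0)$ be a $0$-dimensional ambit. The following conditions are equivalent. (1) $(G,X,x_0)$ has joint. fin. EDRdeg. (2) There exists $\eta\in E(X)$ whose orbit $G\eta$ is finite. (3) Some minimal left ideal in $E(X)$ is finite. (4) Every minimal left ideal in $E(X)$ is finite.
   Context: Compact spaces are Hausdorff. A flow $(G,X)$ is a topological group $G$ acting continuously on a compact space $X$. An ambit $(G,X,x_0)$ is a flow with a distinguished point $x_0\in X$ whose orbit is dense; it is $0$-dimensional if $X$ has a basis of clopen sets. The Ellis semigroup $E(X)$ is the closure in $X^X$ (product topology) of the set of maps $x\mapsto gx$, $g\in G$, with composition; $G$ acts on it by $(g\eta)(x)=g(\eta(x))$. A coloring is a function $c\colon G\to 2^n$, $n\ge 1$. It is externally definable if there are clopen sets $U_0,\dots,U_{n-1}\subseteq X$ and points $y_0,\dots,y_{n-1}\in X$ such that for all $g\in G$, $i<n$: $c(g)(i)=1$ if $y_i\in gU_i$ and $c(g)(i)=0$ if $y_i\notin gU_i$. The ambit has jointly finite externally definable Ramsey degree (joint. fin. EDRdeg) if there is $l\ge 1$ such that for every externally definable coloring $c\colon G\to 2^n$ (any $n\geq 1$), every $k\ge 1$ and every $k$-element $A\subseteq G$, there is $h\in G$ with $|c[hA]|\le l$. *)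

(* Defs.v *)
From HB Require Import structures.
From mathcomp Require Import all_boot monoid.
From mathcomp Require Import boolp classical_sets functions cardinality topology.

Set Implicit Arguments.
Unset Strict Implicit.
Unset Printing Implicit Defensive.

Local Open Scope classical_set_scope.
Local Open Scope card_scope.
Local Open Scope group_scope.

HB.structure Definition PreTopologicalGroup :=
  {G of Topological G & Group G}.

(* The group itself is not assumed to be Hausdorff. *)
HB.mixin Record PreTopologicalGroup_isTopologicalGroup G
    & PreTopologicalGroup G := {
  mulg_continuous : continuous (fun p : G * G => p.1 * p.2) ;
  invg_continuous : continuous (fun x : G => x^-1)
}.

#[short(type="topologicalGroupType")]
HB.structure Definition TopologicalGroup :=
  {G of PreTopologicalGroup G & PreTopologicalGroup_isTopologicalGroup G}.

Section Flows.
Variables (G : topologicalGroupType) (X : topologicalType).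
Variable act : G -> X -> X.

Record is_flow : Prop := IsFlow {
  flow_compact : compact [set: X] ;
  flow_hausdorff : hausdorff_space X ;
  flow_act1 : forall x, act 1 x = x ;
  flow_actM : forall g h x, act (g * h) x = act g (act h x) ;
  flow_continuous : continuous (fun p : G * X => act p.1 p.2)
}.

Record is_ambit (x0 : X) : Prop := IsAmbit {
  ambit_flow : is_flow ;
  ambit_dense : dense [set act g x0 | g in [set: G]]
}.

(* The closure is taken in the topology of pointwise convergence. *)
Definition ellis : set (X -> X) :=
  closure ([set act g | g in [set: G]] : set {ptws X -> X}).

Definition ellis_orbit (eta : X -> X) : set (X -> X) :=
  [set act g \o eta | g in [set: G]].

Definition externally_definable (n : nat) (c : G -> {ffun 'I_n -> bool}) : Prop :=
  exists (U : 'I_n -> set X) (y : 'I_n -> X),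
    (forall i, clopen (U i)) /\
    forall g i, c g i <-> [set act g u | u in U i] (y i).

Definition joint_fin_EDRdeg : Prop :=
  exists2 l : nat, (0 < l)%N &
    forall (n : nat) (c : G -> {ffun 'I_n -> bool}),
      (0 < n)%N -> externally_definable c ->
    forall (k : nat) (A : set G), (0 < k)%N -> A #= `I_k ->
    exists h : G, [set c g | g in [set h * a | a in A]] #<= `I_l.

End Flows.

(* The library's [zero_dimensional] only asks that clopen sets separate points. *)
Definition has_clopen_basis (X : topologicalType) : Prop :=
  exists2 B : set (set X), basis B & B `<=` clopen.

Section Ideals.
Variables (X : Type) (S : set (X -> X)).

(* Left ideals of a composition semigroup [S]; they are nonempty. *)
Definition left_ideal (I : set (X -> X)) : Prop :=
  [/\ I !=set0, I `<=` S & forall s t, S s -> I t -> I (s \o t)].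

Definition minimal_left_ideal (I : set (X -> X)) : Prop :=
  left_ideal I /\ forall J, left_ideal J -> J `<=` I -> J = I.

End Ideals.

(* Main.v *)
Require Import Defs.
From HB Require Import structures.
From mathcomp Require Import all_boot monoid.
From mathcomp Require Import boolp classical_sets functions cardinality topology.

(** Write [E] for the Ellis semigroup.

    A finite family of clopen sets [U_i] and points [y_i] is a test that
    assigns to a map [f] the bit string recording which [f y_i] lie in [U_i],
    its pattern.  Since [y_i] is in [g U_i] exactly when [g^-1 y_i] is in [U_i],
    an externally definable coloring is the map sending [g] to the pattern of
    the action of [g^-1], so condition (1) says: for some [l], all finite tests
    and all finite subsets [A] of the group, some [h] makes the maps [a h] with
    [a] in [A] realize at most [l] patterns ([joint_fin_EDRdegP]).

    Patterns of [a f] are locally constant in [f] for pointwise convergence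
    ([nbhs_pattern_act]), which lets one pass between group elements and their
    limits in [E].  If the orbit of [eta] in [E] is finite, a group element close
    to [eta] realizes no more patterns than the orbit has elements
    ([finite_orbit_bounded_patterns]).  Conversely the bounds for the various
    tests form a downward directed family, so by compactness of the function
    space one limit [eta] obeys all of them ([bounded_patterns_limit]); as
    clopen sets separate points, [l + 1] elements of the orbit of [eta] would be
    told apart by a finite test, so the orbit has at most [l] elements
    ([bounded_patterns_finite_orbit]).

    The remaining conditions are compared inside [E], a closed semigroup in
    which right multiplications are continuous.  Zorn's lemma and compactness
    give a minimal left ideal ([exists_minimal_left_ideal]), and right
    translation carries minimal left ideals to minimal left ideals
    ([minimal_left_ideal_rtrans]).  Right translation by [eta] maps all of [E]
    into the closure of the orbit of [eta]; when this orbit is finite it is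
    closed, whence a finite minimal left ideal.  If [M] is a finite left ideal
    and [n] belongs to a minimal left ideal [N], then [M n] is a left ideal
    inside [N], so it is [N] and [N] is finite.  Finally a left ideal contains
    the orbits of its elements. *)

Local Open Scope classical_set_scope.

(** * Right translates of left ideals *)

Section LeftIdeals.
Set Implicit Arguments.
Unset Strict Implicit.
Variables (X : Type) (S : set (X -> X)).
Hypothesis S_comp : forall s t, S s -> S t -> S (s \o t).

Lemma left_ideal_rtrans M a : left_ideal S M -> S a ->
  left_ideal S [set m \o a | m in M].
Proof.
move=> [[m Mm] MS SM] Sa; split.
- by exists (m \o a), m.
- by move=> _ [n Mn <-]; apply: S_comp => //; exact: MS.
- by move=> s _ Ss [n Mn <-]; exists (s \o n) => //; exact: SM.
Qed.

(** A left ideal [J] inside [M a] pulls back along right translation by [a] to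
    a left ideal inside [M], hence to [M] itself. *)
Lemma minimal_left_ideal_rtrans M a : minimal_left_ideal S M -> S a ->
  minimal_left_ideal S [set m \o a | m in M].
Proof.
move=> [lM minM] Sa; split; first exact: left_ideal_rtrans.
move=> J [[j Jj] JS SJ] JMa; apply/seteqP; split=> //.
have [_ MS SM] := lM.
have preJM : [set m | M m /\ J (m \o a)] = M.
  apply: minM => [|m []//]; split.
  - by have [m Mm mj] := JMa _ Jj; exists m; split=> //; rewrite mj.
  - by move=> m [/MS].
  - by move=> s m Ss [Mm Jm]; split; [exact: SM|exact: (SJ _ (m \o a))].
by move=> _ [m Mm <-]; move: Mm; rewrite -preJM => -[].
Qed.

End LeftIdeals.

(** * Minimal left ideals of compact semigroups of maps *)

Section Pointwise.
Set Implicit Arguments.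
Unset Strict Implicit.
Variable X : topologicalType.
Local Notation Y := {ptws X -> X}.

Lemma ptws_eval_continuous (x : X) : continuous (fun f : Y => f x).
Proof. exact: (@proj_continuous X (fun=> X) x). Qed.

Lemma ptws_continuousP {T : topologicalType} (F : T -> Y) :
  (forall x, continuous (fun t => F t x)) -> continuous F.
Proof.
move=> cF t; apply/cvg_sup => x U [_ [[W oW <-] WFt] WU].
apply: filterS WU _; apply: (cF x t W).
exact: open_nbhs_nbhs.
Qed.

Lemma ptws_rcomp_continuous (t : X -> X) : continuous (fun s : Y => s \o t : Y).
Proof. by apply: ptws_continuousP => x; exact: ptws_eval_continuous. Qed.

Lemma ptws_lcomp_continuous (s : X -> X) : continuous s ->
  continuous (fun t : Y => s \o t : Y).
Proof.
move=> cs; apply: ptws_continuousP => x t.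
apply: (@continuous_comp Y X X (fun t => t x) s); last exact: cs.
exact: ptws_eval_continuous.
Qed.

Hypotheses (cptX : compact [set: X]) (hsX : hausdorff_space X).

Lemma ptws_compact : compact [set: Y].
Proof.
have := @tychonoff X (fun=> X) (fun=> setT) (fun=> cptX).
by congr compact; apply/seteqP; split.
Qed.

Lemma ptws_hausdorff : hausdorff_space Y.
Proof. exact: (@hausdorff_product X (fun=> X) (fun=> hsX)). Qed.

(** Zorn's lemma gives a left ideal minimal among the closed ones.  It is
    minimal among all left ideals, because a left ideal containing [t] contains
    the left ideal [S t], which is closed as a continuous image of a compact
    set. *)
Lemma exists_minimal_left_ideal (S : set Y) :
  S !=set0 -> closed S -> (forall s t, S s -> S t -> S (s \o t)) ->
  exists M, minimal_left_ideal S M.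
Proof.
move=> S0 clS S_comp.
have cptS : compact S by apply: subclosed_compact clS ptws_compact _.
(* Closed left ideals are handled through their complements [A], for which
   minimality becomes maximality. *)
have [|A [[oA lA] maxA]] :=
    @Zorn_bigcup Y (fun A : set Y => open A /\ left_ideal S (S `\` A)).
  move=> F FP totF; split.
    by apply: bigcup_open => A /FP[].
  split.
  - have [->|/set0P[A0 FA0]] := eqVneq F set0.
      by rewrite bigcup_set0 setD0.
    (* The sets [S `\` A] form a chain of nonempty closed subsets of a compact
       set; a cluster point lies in all of them. *)
    have FF : ProperFilter (filter_from F (fun A => S `\` A)).
      apply: filter_from_proper => [|A /FP[_ []]//].
      apply: filter_from_filter; first by exists A0.
      move=> A B FA FB; have [AB|BA] := totF _ _ FA FB.
        by exists B => // f [Sf nBf]; split; split=> // /AB.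
      by exists A => // f [Sf nAf]; split; split=> // /BA.
    have [|f [Sf clf]] := cptS _ FF; first by exists A0 => // ? [].
    exists f; split=> // -[A FA Af].
    have oA : open A by have [] := FP _ FA.
    have [|g [[_ nAg] Ag]] := clf (S `\` A) A _ (open_nbhs_nbhs (conj oA Af)).
      by exists A.
    exact: nAg.
  - by move=> ? [].
  - move=> s t Ss [St nFt]; split; first exact: S_comp.
    move=> [A FA Ast]; have [_ [_ _ lA]] := FP _ FA.
    have [|_] := lA s t Ss; last exact.
    by split=> // At; apply: nFt; exists A.
exists (S `\` A); split=> // J lJ JM.
have [[t Jt] _ SJ] := lJ.
have St : S t by have [] := JM _ Jt.
pose St' : set Y := [set s \o t | s in S].
have St'J : St' `<=` J by move=> _ [s Ss <-]; exact: SJ.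
apply/seteqP; split=> // f [Sf nAf]; apply: (St'J).
apply: contrapT => nf; apply: (maxA (~` St')).
  by split=> [g Ag /St'J /JM[]|/(_ f nf)].
split.
- apply: closed_openC; apply: compact_closed; first exact: ptws_hausdorff.
  apply: continuous_compact cptS.
  by apply: continuous_subspaceT; exact: ptws_rcomp_continuous.
- have lS : left_ideal S S by split.
  suff -> : S `\` ~` St' = St' by exact: left_ideal_rtrans.
  apply/seteqP; split=> [g [_ /contrapT]//|g [s Ss <-]].
  by split; [exact: S_comp|apply; exists s].
Qed.

End Pointwise.

(** * Patterns of maps on clopen tests *)

Section Patterns.
Set Implicit Arguments.
Unset Strict Implicit.
Variable X : topologicalType.
Local Notation Y := {ptws X -> X}.
Implicit Types (s : seq (set X * X)) (f : X -> X).

Definition clopen_tests s := forall p, p \in s -> clopen p.1.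

Definition pattern s f : seq bool := [seq `[< p.1 (f p.2) >] | p <- s].

(** A pattern involves finitely many coordinates, and a clopen condition on each
    of them, so it is locally constant for pointwise convergence. *)
Lemma nbhs_pattern s (b : X -> X) (eta : Y) : clopen_tests s -> continuous b ->
  \forall f \near eta, pattern s (b \o f) = pattern s (b \o eta).
Proof.
move=> cs cb; elim: s cs => [_|p s IH cs].
  by apply: (@filterE _ (nbhs eta)) => f.
have IHs := IH (fun q qs => cs q (mem_behead (s := p :: s) qs)).
have cbf : continuous (fun f : Y => b (f p.2)).
  move=> f; apply: (@continuous_comp Y X X (fun f => f p.2) b); last exact: cb.
  exact: ptws_eval_continuous.
have [oU cU] := preimage_clopen (cs p (mem_head _ _)) cbf.
have near_p : \forall f \near eta, p.1 (b (f p.2)) = p.1 (b (eta p.2)).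
  have [Up|nUp] := pselect (p.1 (b (eta p.2))).
    apply: filterS (open_nbhs_nbhs (conj oU Up)) => f Uf.
    by apply/propext; split.
  apply: filterS (open_nbhs_nbhs (conj (closed_openC cU) nUp)) => f Uf.
  by apply/propext; split.
have nbhsF : Filter (nbhs eta) := nbhs_filter eta.
apply: filterS2 near_p IHs => f Ep Es.
by rewrite /pattern /= Ep; congr (_ :: _); exact: Es.
Qed.

End Patterns.

(** * Finite ideals and finite orbits in the Ellis semigroup *)

Section EllisSemigroup.
Set Implicit Arguments.
Unset Strict Implicit.
Local Open Scope card_scope.
Variables (G : topologicalGroupType) (X : topologicalType) (act : G -> X -> X).
Local Notation Y := {ptws X -> X}.
Local Notation E := (ellis act).
Hypothesis flow : is_flow act.

Lemma act_continuous g : continuous (act g).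
Proof.
move=> x; apply: (@continuous_comp _ _ _ (fun x => (g, x)) (fun p => act p.1 p.2)).
  by apply: cvg_pair; [exact: cvg_cst|exact: cvg_id].
exact: flow_continuous.
Qed.

Lemma ellis_act g : E (act g).
Proof. by apply: subset_closure; exists g. Qed.

(** Right composition with [t] is continuous, so it maps the closure of the group
    into any closed set containing the orbit of [t]. *)
Lemma ellis_rcomp_sub (t : X -> X) (C : set Y) : closed C ->
  ellis_orbit act t `<=` C -> forall s, E s -> C (s \o t).
Proof.
move=> cC orbC s Es.
have cl : closed [set s : Y | C (s \o t)].
  apply: (@preimage_closed Y Y (fun s => s \o t) C) cC => f _.
  exact: ptws_rcomp_continuous.
rewrite /ellis closureE in Es; apply: (Es [set s : Y | C (s \o t)]).
by split=> // _ [g _ <-]; apply: orbC; exists g.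
Qed.

Lemma ellis_comp s t : E s -> E t -> E (s \o t).
Proof.
move=> Es Et; apply: (@ellis_rcomp_sub t E) Es; first exact: closed_closure.
move=> _ [g _ <-].
(* Composing with [act g] on the left is continuous in [t] because [act g] is
   a continuous map; a general element of the Ellis semigroup is not. *)
have cl : closed [set t : Y | E (act g \o t)].
  apply: (@preimage_closed Y Y (fun t => act g \o t) E) => [f _|].
    by apply: ptws_lcomp_continuous; exact: act_continuous.
  exact: closed_closure.
rewrite /ellis closureE in Et; apply: (Et [set t : Y | E (act g \o t)]).
split=> // _ [h _ <-] /=.
have -> : act g \o act h = act (g * h)%g.
  by apply/funext => x; rewrite /= (flow_actM flow).
exact: ellis_act.
Qed.

Lemma ellis_minimal_left_ideal : exists M, minimal_left_ideal E M.
Proof.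
apply: exists_minimal_left_ideal (flow_compact flow) (flow_hausdorff flow) _ _ _ _.
- by exists (act 1%g); exact: ellis_act.
- exact: closed_closure.
- exact: ellis_comp.
Qed.

(** A finite orbit is closed, so nothing new appears in its closure. *)
Lemma ellis_rcomp_finite eta s :
  finite_set (ellis_orbit act eta) -> E s -> ellis_orbit act eta (s \o eta).
Proof.
move=> fin; apply: (@ellis_rcomp_sub eta (ellis_orbit act eta)) => //.
apply: (@accessible_finite_set_closed Y).1 fin; apply: hausdorff_accessible.
exact: ptws_hausdorff (flow_hausdorff flow).
Qed.

Lemma finite_orbit_minimal_left_ideal eta :
  E eta -> finite_set (ellis_orbit act eta) ->
  exists2 M, minimal_left_ideal E M & finite_set M.
Proof.
move=> Eeta fin; have [M minM] := ellis_minimal_left_ideal.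
exists [set m \o eta | m in M].
  by apply: minimal_left_ideal_rtrans => //; exact: ellis_comp.
apply: (sub_finite_set _ fin) => _ [m Mm <-]; apply: ellis_rcomp_finite => //.
by have [[_ ME _] _] := minM; exact: ME.
Qed.

Lemma minimal_left_ideal_finite M N : left_ideal E M -> finite_set M ->
  minimal_left_ideal E N -> finite_set N.
Proof.
move=> lM finM [[[n Nn] NE EN] minN].
suff <- : [set m \o n | m in M] = N by exact: finite_image.
apply: minN; first by apply: left_ideal_rtrans => //; [exact: ellis_comp|exact: NE].
by move=> _ [m Mm <-]; apply: EN => //; have [_ ME _] := lM; exact: ME.
Qed.

Lemma finite_left_ideal_orbit M : left_ideal E M -> finite_set M ->
  exists2 eta, E eta & finite_set (ellis_orbit act eta).
Proof.
move=> [[m Mm] ME EM] finM; exists m; first exact: ME.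
by apply: sub_finite_set finM => _ [g _ <-]; apply: EM => //; exact: ellis_act.
Qed.

(** * Ramsey degree as a bound on patterns *)

(** The Ramsey property with colorings replaced by patterns; a translate [hA] in
    the group becomes [A^-1 h^-1] here. *)
Definition bounded_patterns (l : nat) :=
  forall (s : seq (set X * X)) (A : set G), clopen_tests s -> finite_set A ->
  exists h : G, [set pattern s (act a \o act h) | a in A] #<= `I_l.

Lemma coloringE (U : set X) (y : X) g :
  [set act g u | u in U] y <-> U (act g^-1%g y).
Proof.
split=> [[u Uu <-]|Uy].
  by rewrite -(flow_actM flow) mulVg (flow_act1 flow).
by exists (act g^-1%g y) => //; rewrite -(flow_actM flow) mulgV (flow_act1 flow).
Qed.

(** A coloring and the pattern of the corresponding test hold the same bits, as
    a finite function and as a sequence: each set of values is an image of the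
    other, so bounds on their cardinals agree. *)
Lemma joint_fin_EDRdegP :
  joint_fin_EDRdeg act <-> exists2 l, (0 < l)%N & bounded_patterns l.
Proof.
split=> -[l l0 H]; exists l => //.
- move=> s A cs finA.
  have [s0|s_gt0] := posnP (size s).
    exists 1%g; rewrite (size0nil s0).
    apply: (@card_le_trans _ _ _ `I_1); last by rewrite card_le_II.
    apply: (@card_le_trans _ _ _ [set [::] : seq bool]).
      by apply: subset_card_le => _ [a _ <-].
    by have /card_eqPle[] := @card_set1 _ ([::] : seq bool).
  have [A0|A_neq0] := eqVneq A set0.
    by exists 1%g; rewrite A0 image_set0; exact: card_ge0.
  pose t := in_tuple s.
  pose c g := [ffun i : 'I_(size s) =>
    `[< (tnth t i).1 (act g^-1%g (tnth t i).2) >]].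
  have edc : externally_definable act c.
    exists (fun i => (tnth t i).1), (fun i => (tnth t i).2); split.
      by move=> i; apply: cs; exact: mem_tnth.
    move=> g i; rewrite ffunE coloringE; split=> [/asboolP//|?].
    exact/asboolP.
  have patE g : pattern s (act g) = [seq c g^-1%g i | i <- enum 'I_(size s)].
    have {1}-> : s = [seq tnth t i | i <- enum 'I_(size s)].
      by rewrite map_tnth_enum.
    rewrite /pattern -map_comp.
    by apply: eq_map => i /=; rewrite ffunE invgK.
  pose A' := [set a^-1%g | a in A].
  have [k A'k] := (finite_setP A').1 (finite_image _ finA).
  have k0 : (0 < k)%N.
    rewrite lt0n; apply: contraNN A_neq0 => /eqP k0; move: A'k.
    rewrite k0 II0 card_eq0 => /eqP A'0; apply/eqP/seteqP; split=> // a Aa.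
    by have : A' a^-1%g by [exists a]; rewrite A'0.
  have [h hl] := H _ c s_gt0 edc k A' k0 A'k.
  exists h^-1%g; apply: card_le_trans hl.
  apply: (@card_le_trans _ _ _
    ((fun v : {ffun 'I_(size s) -> bool} => [seq v i | i <- enum 'I_(size s)])
      @` [set c g | g in [set (h * a)%g | a in A']])); last exact: card_image_le.
  apply: subset_card_le => _ [a Aa <-].
  exists (c (h * a^-1)%g).
    by exists (h * a^-1)%g => //; exists a^-1%g => //; exists a.
  have -> : act a \o act h^-1%g = act (a * h^-1)%g.
    by apply/funext => x; rewrite /= (flow_actM flow).
  by rewrite patE invgM invgK.
- move=> n c n0 [U [y [cU cE]]] k A k0 Ak.
  pose s := [seq (U i, y i) | i <- enum 'I_n].
  have cs : clopen_tests s by move=> _ /mapP[i _ ->]; exact: cU.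
  have finA : finite_set [set a^-1%g | a in A].
    by apply: finite_image; apply/finite_setP; exists k.
  have [h hl] := H s _ cs finA.
  exists h^-1%g; apply: card_le_trans hl.
  apply: (@card_le_trans _ _ _
    ((fun v : seq bool => [ffun i : 'I_n => nth false v i])
      @` [set pattern s (act a \o act h) | a in [set a^-1%g | a in A]]));
    last exact: card_image_le.
  apply: subset_card_le => _ [_ [a Aa <-] <-].
  exists (pattern s (act a^-1%g \o act h)).
    by exists a^-1%g => //; exists a.
  apply/ffunP => i; have i_enum : (i < size (enum 'I_n))%N by rewrite size_enum_ord.
  rewrite ffunE (nth_map (U i, y i)); last by rewrite size_map.
  rewrite (nth_map i) // nth_ord_enum /=.
  rewrite -(flow_actM flow) -[in X in act X](invgK h) -invgM.
  by apply/asboolP/idP => [/coloringE /cE|/cE /coloringE].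
Qed.

Lemma nbhs_pattern_act s (A : set G) (eta : Y) :
  clopen_tests s -> finite_set A ->
  \forall f \near eta, forall a, A a ->
    pattern s (act a \o f) = pattern s (act a \o eta).
Proof.
move=> cs /finite_fsetP[D ->].
apply: (@filter_bigI Y G D
  (fun a => [set f : Y | pattern s (act a \o f) = pattern s (act a \o eta)])).
by move=> a _; apply: nbhs_pattern => //; exact: act_continuous.
Qed.

(** * Passing between group elements and limits *)

(** A group element [h] close to [eta] has the same patterns as [eta] after
    translation by [A], and those come from the finite orbit of [eta]. *)
Lemma finite_orbit_bounded_patterns eta :
  E eta -> finite_set (ellis_orbit act eta) ->
  exists2 l, (0 < l)%N & bounded_patterns l.
Proof.
(* The successor only serves to make the bound visibly positive. *)
move=> Eeta /finite_set_leP[n orbn]; exists n.+1 => // s A cs finA.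
have [_ [[h _ <-] hA]] := Eeta _ (nbhs_pattern_act eta cs finA).
exists h; apply: (@card_le_trans _ _ _ `I_n); last by rewrite card_le_II.
apply: card_le_trans orbn.
apply: (@card_le_trans _ _ _ (pattern s @` ellis_orbit act eta)).
  apply: subset_card_le => _ [a Aa <-]; rewrite hA //.
  by exists (act a \o eta) => //; exists a.
exact: card_image_le.
Qed.

Hypothesis clopenX : has_clopen_basis X.

Lemma clopen_separation (x y : X) : x <> y -> exists U, [/\ clopen U, U x & ~ U y].
Proof.
move=> /eqP /(hausdorff_accessible (flow_hausdorff flow)) [V [oV /set_mem Vx /set_mem nVy]].
have [B [_ Bb] Bclopen] := clopenX.
have [U [BU Ux] UV] := Bb x V (open_nbhs_nbhs (conj oV Vx)).
exists U; split=> //; first exact: Bclopen.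
by move=> /UV.
Qed.

(** Enlarging the test or [A] makes the bound stronger, so the sets of group
    elements obeying the bounds generate a proper filter; any cluster point of it
    inherits every bound since patterns are locally constant. *)
Lemma bounded_patterns_limit l : bounded_patterns l ->
  exists2 eta : Y, E eta & forall s A, clopen_tests s -> finite_set A ->
    [set pattern s (act a \o eta) | a in A] #<= `I_l.
Proof.
move=> bp.
pose B (i : seq (set X * X) * set G) : set Y := [set f | (exists h, f = act h) /\
  [set pattern i.1 (act a \o f) | a in i.2] #<= `I_l].
pose D := [set i : seq (set X * X) * set G | clopen_tests i.1 /\ finite_set i.2].
have FB : ProperFilter (filter_from D B).
  apply: filter_from_proper => [|[s A] [cs finA]]; last first.
    by have [h hl] := bp s A cs finA; exists (act h); split=> //; exists h.
  apply: filter_from_filter; first by exists ([::], set0); split.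
  move=> [s A] [s' A'] [/= cs finA] [/= cs' finA'].
  exists (s ++ s', A `|` A').
    split=> /=; last by rewrite finite_setU.
    by move=> p; rewrite mem_cat => /orP[/cs|/cs'].
  (* A pattern on a concatenated test determines the patterns on both parts by
     truncation. *)
  move=> f [fact fl]; split; split=> //; apply: card_le_trans fl.
  - apply: (@card_le_trans _ _ _ (take (size s) @`
      [set pattern (s ++ s') (act a \o f) | a in A `|` A']));
      last exact: card_image_le.
    apply: subset_card_le => _ [a Aa <-].
    exists (pattern (s ++ s') (act a \o f)); first by exists a => //; left.
    by rewrite /pattern map_cat take_size_cat // size_map.
  - apply: (@card_le_trans _ _ _ (drop (size s) @`
      [set pattern (s ++ s') (act a \o f) | a in A `|` A']));
      last exact: card_image_le.
    apply: subset_card_le => _ [a Aa <-].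
    exists (pattern (s ++ s') (act a \o f)); first by exists a => //; right.
    by rewrite /pattern map_cat drop_size_cat // size_map.
have [|eta [_ cleta]] := ptws_compact (flow_compact flow) FB.
  by exists ([::], set0).
exists eta.
  move=> N /(cleta (B ([::], set0))) [|f [[[h ->] _] Nh]].
    by exists ([::], set0).
  by exists (act h); split=> //; exists h.
move=> s A cs finA.
have [|f [[_ fl] fA]] := cleta (B (s, A)) _ _ (nbhs_pattern_act eta cs finA).
  by exists (s, A).
apply: card_le_trans fl; apply: subset_card_le => _ [a Aa <-].
by exists a => //; exact: fA.
Qed.

(** If the orbit were infinite, [l + 1] distinct elements of it could be
    separated pairwise by clopen sets, and the test collecting these separations
    would exhibit [l + 1] patterns. *)
Lemma bounded_patterns_finite_orbit l (x0 : X) (eta : Y) :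
  (forall s A, clopen_tests s -> finite_set A ->
    [set pattern s (act a \o eta) | a in A] #<= `I_l) ->
  finite_set (ellis_orbit act eta).
Proof.
move=> bp; apply/finite_setPn => /card_leP[f].
pose F (i : nat) : X -> X := val (f (SigSub (mem_set (I : [set: nat] i)))).
have F_inj : injective F.
  move=> i j /val_inj fij.
  by have /(congr1 val) := @inj _ _ _ f _ _ (mem_set I) (mem_set I) fij.
have /choice[a aE] : forall i, exists a, act a \o eta = F i.
  move=> i; have [a _ aE] := set_valP (f (SigSub (mem_set (I : [set: nat] i)))).
  by exists a.
have /choice[t tP] : forall ij : 'I_l.+1 * 'I_l.+1, exists p : set X * X,
    clopen p.1 /\ (ij.1 != ij.2 ->
      p.1 (act (a ij.1) (eta p.2)) /\ ~ p.1 (act (a ij.2) (eta p.2))).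
  move=> [i j] /=; have [<-|ij] := eqVneq i j.
    (* On the diagonal any clopen set serves as a default. *)
    by exists (set0, x0); split=> //; exact: clopen0.
  have /existsNP[x /clopen_separation[U [cU Ui Uj]]] :
      ~ forall x, act (a i) (eta x) = act (a j) (eta x).
    move=> ijE; move/eqP: ij; apply; apply/val_inj/F_inj.
    by rewrite -!aE; exact/funext.
  by exists (U, x).
pose s := [seq t ij | ij <- enum {: 'I_l.+1 * 'I_l.+1}].
have cs : clopen_tests s by move=> _ /mapP[ij _ ->]; have [] := tP ij.
pose g (i : 'I_l.+1) := pattern s (act (a i) \o eta).
have g_inj : injective g.
  move=> i j gij; apply: contrapT => /eqP ij.
  have [_ /(_ ij)[Ui Uj]] := tP (i, j).
  have /eq_in_map/(_ (t (i, j))) := gij.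
  rewrite asboolT // asboolF // => /(_ _)/negP; apply=> //.
  by rewrite map_f // mem_enum.
have := bp s _ cs (finite_image a (finite_II l.+1)).
apply/negP; apply: contraFN (ltnn l); rewrite -card_le_II.
apply: card_le_trans.
apply: (@card_le_trans _ _ _ [set: 'I_l.+1]); first by have /card_eqPle[] := @card_II l.+1.
have /card_eqPle[_ ] : g @` setT #= [set: 'I_l.+1].
  by apply: inj_card_eq => i j _ _; exact: g_inj.
move=> /card_le_trans; apply; apply: subset_card_le => _ [i _ <-].
by exists (a i) => //; exists (val i) => //=.
Qed.

End EllisSemigroup.

Theorem proposition3p27 (G : topologicalGroupType) (X : topologicalType)
    (act : G -> X -> X) (x0 : X) :
  is_ambit act x0 -> has_clopen_basis X ->
  [<-> joint_fin_EDRdeg act;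
       exists2 eta, ellis act eta & finite_set (ellis_orbit act eta);
       exists2 M, minimal_left_ideal (ellis act) M & finite_set M;
       forall M, minimal_left_ideal (ellis act) M -> finite_set M].
Proof.
move=> [flow _] clopenX; tfae.
- move=> /(joint_fin_EDRdegP flow)[l _ /(bounded_patterns_limit flow)].
  move=> [eta Eeta bp]; exists eta => //.
  exact: (bounded_patterns_finite_orbit flow clopenX x0 bp).
- by move=> [eta]; exact: finite_orbit_minimal_left_ideal.
- by move=> [M [lM _] finM] N; exact: minimal_left_ideal_finite lM finM.
- move=> fin; have [M minM] := ellis_minimal_left_ideal flow.
  have [eta Eeta orb] := finite_left_ideal_orbit minM.1 (fin M minM).
  apply/joint_fin_EDRdegP => //.
  exact: (finite_orbit_bounded_patterns flow Eeta orb).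
Qed.
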